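(* Let $\Omega\subseteq\mathbb{R}^n$ be either $\mathbb{R}^n$ or a (bounded or unbounded) domain with smooth boundary containing the origin. Let $\alpha\in\mathbb{R}$, $t\in\mathbb{R}$, $1\le p<\infty$, and assume $Q+\alpha-p>0$. Then for every $\phi\in C_0^\infty(\Omega)$, $$\int_\Omega\rho^{\alpha}|\nabla_\gamma\rho|^t|\nabla_\gamma\phi|^p\,dz\ \ge\ \Big(\frac{Q+\alpha-p}{p}\Big)^p\int_\Omega\rho^{\alpha}|\nabla_\gamma\rho|^t\frac{|\nabla_\gamma\rho|^p}{\rho^p}|\phi|^p\,dz .$$
   Context: Points of $\mathbb{R}^n$ are written $z=(x,y)$ with $x\in\mathbb{R}^m$, $y\in\mathbb{R}^k$, $m,k\ge1$, $n=m+k$, and $\gamma>0$. The Baouendi–Grushin gradient is $\nabla_\gamma=(\partial_{x_1},\dots,\partial_{x_m},|x|^\gamma\partial_{y_1},\dots,|x|^\gamma\partial_{y_k})$. The homogeneous dimension is $Q=m+(1+\gamma)k$. The gauge is $\rho(z)=\big(|x|^{2(1+\gamma)}+(1+\gamma)^2|y|^2\big)^{\frac{1}{2(1+\gamma)}}$; one has $|\nabla_\gamma\rho|=|x|^\gamma/\rho^\gamma$. The integral on the left-hand side is allowed to be $+\infty$. *)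

(* Defs.v *)
From HB Require Import structures.
From mathcomp Require Import all_boot all_order all_algebra.
From mathcomp Require Import all_classical all_reals all_analysis.
Set Implicit Arguments. Unset Strict Implicit. Unset Printing Implicit Defensive.
Import Order.TTheory GRing.Theory Num.Theory.
Import numFieldNormedType.Exports.
Local Open Scope classical_set_scope.
Local Open Scope ring_scope.

Section Defs.
Variable R : realType.

Definition enorm (n : nat) (v : 'rV[R]_n) : R :=
  Num.sqrt (\sum_(i < n) v ord0 i ^+ 2).

Definition evec (n : nat) (i : 'I_n) : 'rV[R]_n := delta_mx ord0 i.

Fixpoint iter_partial (n : nat) (s : seq 'I_n) (f : 'rV[R]_n -> R)
  : 'rV[R]_n -> R :=
  match s with
  | [::] => f
  | i :: s' => fun z => 'D_(evec i) (iter_partial s' f) z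
  end.

Definition smooth (n : nat) (f : 'rV[R]_n -> R) : Prop :=
  forall s : seq 'I_n,
    continuous (iter_partial s f) /\
    forall (i : 'I_n) (z : 'rV[R]_n), derivable (iter_partial s f) z (evec i).

Definition Ccinf (n : nat) (Omega : set 'rV[R]_n) (f : 'rV[R]_n -> R) : Prop :=
  smooth f /\
  exists K : set 'rV[R]_n,
    compact K /\ K `<=` Omega /\ (forall z, ~ K z -> f z = 0).

Definition domain (n : nat) (Omega : set 'rV[R]_n) : Prop :=
  open Omega /\ connected Omega /\ Omega !=set0.

Definition smooth_boundary (n : nat) (Omega : set 'rV[R]_n) : Prop :=
  forall z0, (closure Omega `\` Omega) z0 ->
    exists (r : R) (g : 'rV[R]_n -> R),
      0 < r /\ smooth g /\
      (exists i : 'I_n, 'D_(evec i) g z0 != 0) /\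
      Omega `&` ball z0 r = [set z | ball z0 r z /\ g z < 0].

Fixpoint iint (n : nat) : ('rV[R]_n -> \bar R) -> \bar R :=
  match n with
  | O => fun f => f 0
  | n'.+1 => fun f =>
      (\int[lebesgue_measure]_(s in [set: R])
         iint (fun v : 'rV[R]_n' => f (row_mx (\row_(_ < 1) s) v)))%E
  end.

Definition integral_over (n : nat) (Omega : set 'rV[R]_n)
  (F : 'rV[R]_n -> R) : \bar R :=
  iint (fun z => (\1_Omega z * F z)%:E).

Section Grushin.
Variables (m k : nat) (gamma : R).

Definition xpart (z : 'rV[R]_(m + k)) : 'rV[R]_m := lsubmx z.
Definition ypart (z : 'rV[R]_(m + k)) : 'rV[R]_k := rsubmx z.

Definition grushin_grad_norm (f : 'rV[R]_(m + k) -> R) (z : 'rV[R]_(m + k)) : R :=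
  Num.sqrt (\sum_(i < m) ('D_(evec (lshift k i)) f z) ^+ 2
          + \sum_(j < k) (enorm (xpart z) `^ gamma
                           * 'D_(evec (rshift m j)) f z) ^+ 2).

Definition hom_dim : R := m%:R + (1 + gamma) * k%:R.

Definition gauge (z : 'rV[R]_(m + k)) : R :=
  (enorm (xpart z) `^ (2 * (1 + gamma)) + (1 + gamma) ^+ 2 * enorm (ypart z) ^+ 2)
    `^ (1 / (2 * (1 + gamma))).

End Grushin.
End Defs.

Arguments gauge {R} m k gamma z.
Arguments grushin_grad_norm {R} m k gamma f z.

(* Main.v *)
Require Import Defs.
From HB Require Import structures.
From mathcomp Require Import all_boot all_order all_algebra.
From mathcomp Require Import all_classical all_reals all_analysis.
From mathcomp Require Import measurable_realfun ring.
Import Order.TTheory GRing.Theory Num.Theory.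
Import numFieldNormedType.Exports.
Local Open Scope classical_set_scope.
Local Open Scope ring_scope.

Set Implicit Arguments. Unset Strict Implicit. Unset Printing Implicit Defensive.

(** The Cauchy-Schwarz inequality gives
    [(|grad rho| / rho) |Z phi| <= |grad phi|] off [x = 0], where
    [Z = x . d_x + (1 + gamma) y . d_y] generates the dilations
    [delta_s (x, y) = (e^s x, e^((1 + gamma) s) y)], and both [|grad rho|] and
    [rho] are homogeneous for [delta_s].  The weight
    [W = rho^alpha |grad rho|^(t + p) / rho^p] is therefore homogeneous of degree
    [alpha - p], and it remains to prove a Hardy inequality between [phi] and
    [Z phi] for an arbitrary nonnegative homogeneous weight.  Along an orbit,
    [phi] vanishes for large [s], so [phi (z)] is minus the integral of
    [(Z phi) (delta_s z)] over [s > 0]; with [c = (Q + alpha - p) / p], Young's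
    inequality bounds [|phi z|^p] by [c^-p] times the mean of
    [e^(c p s) |(Z phi) (delta_s z)|^p] under the exponential law of rate [c].
    Integrating against [W dz], Tonelli's theorem and the scaling of Lebesgue
    measure make all the exponential factors cancel.  Every step is an
    inequality between nonnegative, possibly infinite, integrals, so no
    integrability of the weight is required. *)

(** * Measurability and Tonelli for the iterated integral *)

Definition coord_measurable (R : realType) d (T : measurableType d) n
    (v : T -> 'rV[R]_n) : Prop :=
  forall i, measurable_fun setT (fun t => v t ord0 i).

(* Row vectors carry no sigma-algebra in the library, so joint measurability is
   tested along all maps with measurable coordinates. *)
Definition param_measurable (R : realType) d (T : measurableType d) n
    d'' (U : measurableType d'') (f : T -> 'rV[R]_n -> U) : Prop :=
  forall d' (T' : measurableType d') (a : T' -> T) (v : T' -> 'rV[R]_n),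
    measurable_fun setT a -> coord_measurable v ->
    measurable_fun setT (fun t => f (a t) (v t)).

Definition vec_measurable (R : realType) n d'' (U : measurableType d'')
    (f : 'rV[R]_n -> U) : Prop :=
  forall d' (T' : measurableType d') (v : T' -> 'rV[R]_n),
    coord_measurable v -> measurable_fun setT (fun t => f (v t)).

Lemma coord_measurable_row_mx (R : realType) d (T : measurableType d) n
    (s : T -> R) (v : T -> 'rV[R]_n) :
  measurable_fun setT s -> coord_measurable v ->
  coord_measurable (fun t => row_mx (\row_(_ < 1) s t) (v t)).
Proof.
move=> ms mv i; have [j ->|j ->] := @split_ordP 1 n i.
- by apply: eq_measurable_fun ms => t _; rewrite row_mxEl mxE.
- by apply: eq_measurable_fun (mv j) => t _; rewrite row_mxEr.
Qed.

Lemma param_measurable_slice (R : realType) d (T : measurableType d) n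
    d'' (U : measurableType d'') (f : T -> 'rV[R]_n -> U) t :
  param_measurable f -> vec_measurable (f t).
Proof. by move=> mf d' T' v mv; apply: (mf _ _ (fun=> t)). Qed.

Lemma param_measurable_row_mx (R : realType) d (T : measurableType d) n
    d'' (U : measurableType d'') (f : T -> 'rV[R]_n.+1 -> U) :
  param_measurable f ->
  param_measurable (fun (p : T * measurableTypeR R) (v : 'rV[R]_n) =>
    f p.1 (row_mx (\row_(_ < 1) p.2) v)).
Proof.
move=> mf d' T' a v ma mv; apply: mf.
  exact: (measurableT_comp measurable_fst ma).
apply: coord_measurable_row_mx mv.
exact: (measurableT_comp measurable_snd ma).
Qed.

Lemma vec_measurable_row_mx (R : realType) n d'' (U : measurableType d'')
    (f : 'rV[R]_n.+1 -> U) :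
  vec_measurable f ->
  param_measurable (fun (s : measurableTypeR R) (v : 'rV[R]_n) =>
    f (row_mx (\row_(_ < 1) s) v)).
Proof.
by move=> mf d' T' a v ma mv; apply: mf; apply: coord_measurable_row_mx.
Qed.

(** Cubes with rational centre and radius [1/(N+1)] form a countable base of the topology; this is
    what makes preimages of open sets countable unions below. *)
Lemma rational_ball_approx (R : realType) n (A : set 'rV[R]_n)
    (x : 'rV[R]_n) :
  nbhs x A -> exists (q : 'rV[rat]_n) (N : nat),
  (forall i, `|x ord0 i - ratr (q ord0 i)| < N.+1%:R^-1) /\
  (forall y : 'rV[R]_n, (forall i, `|y ord0 i - ratr (q ord0 i)| < N.+1%:R^-1) -> A y).
Proof.
move=> /nbhs_ballP[e /= e0 eA].
(* The radius is taken below [e/2], since [x] and [y] are compared through the centre [q]. *)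
have [N _ Ne] := near_infty_natSinv_lt (PosNum (divr_gt0 e0 (ltr0n R 2))).
have {}Ne := Ne N (leqnn N).
have h i : exists q : rat, `|x ord0 i - ratr q| < N.+1%:R^-1.
  have : x ord0 i - N.+1%:R^-1 < x ord0 i by rewrite ltrBlDr ltrDl invr_gt0.
  move=> /rat_in_itvoo[q]; rewrite in_itv/= => /andP[q1 q2]; exists q.
  by rewrite ger0_norm ?subr_ge0 ?ltW// ltrBlDr addrC -ltrBlDr.
have [q hq] := choice h.
exists (\row_i q i), N; split=> [i|y hy]; first by rewrite mxE.
apply: eA; split => // i j; rewrite (ord1 i) /ball /= .
have := hy j; rewrite mxE => hyj.
rewrite (_ : x ord0 j - y ord0 j =
  (x ord0 j - ratr (q j)) - (y ord0 j - ratr (q j))); last first.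
  by rewrite opprB addrA subrK.
by rewrite (le_lt_trans (ler_normB _ _))// [ltRHS]splitr ltrD// (lt_trans _ Ne).
Qed.

(** The preimage of an open ray is open, hence a countable union of rational cubes, and membership
    in a cube is a finite set of measurable conditions on the coordinates. *)
Lemma continuous_vec_measurable (R : realType) n (f : 'rV[R]_n -> R) :
  continuous f -> vec_measurable (f : 'rV[R]_n -> measurableTypeR R).
Proof.
move=> cf d T v mv.
apply: (measurability _ (RGenOInfty.measurableE R)) => //.
move=> _ [_ [x ->] <-]; rewrite setTI.
have oA : open (f @^-1` `]x, +oo[).
  by apply: open_comp => // y _; exact: cf.
pose B (p : 'rV[rat]_n * nat) : set 'rV[R]_n :=
  [set y : 'rV[R]_n | forall i, `|y ord0 i - ratr (p.1 ord0 i)| < p.2.+1%:R^-1].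
pose I := [set p | B p `<=` f @^-1` `]x, +oo[].
rewrite [X in measurable X](_ : _ =
    \bigcup_p (if p \in I then v @^-1` B p else set0)); last first.
  apply/seteqP; split => [t vt|t [p _]].
    have [q [N [h1 h2]]] := @rational_ball_approx _ _ _ _ (oA _ vt).
    by exists (q, N) => //; case: ifPn => //; rewrite notin_setE => /(_ h2).
  by case: ifPn => // /set_mem; exact.
apply: countable_bigcupT_measurable; first exact: countableP.
move=> p; case: ifPn => // _.
rewrite (_ : v @^-1` B p = \bigcap_(i in [set: 'I_n])
    [set t | `|v t ord0 i - ratr (p.1 ord0 i)| < p.2.+1%:R^-1]); last first.
  by apply/seteqP; split => [t h i _|t h i]; [exact: h|exact: h].
apply: fin_bigcap_measurable; first exact: finite_finset.
move=> i _.
have : measurable_fun setT (fun t => `|v t ord0 i - ratr (p.1 ord0 i)|).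
  apply: measurableT_comp => //; apply: measurable_funB => //; exact: mv.
move=> /(_ measurableT `]-oo, p.2.+1%:R^-1[%classic (measurable_itv _)).
by rewrite setTI.
Qed.

Lemma row_mx_first (R : realType) n (s : R) (v : 'rV[R]_n) (i : 'I_n.+1) :
  val i = 0%N -> (row_mx (\row_(_ < 1) s) v : 'rV_n.+1) ord0 i = s.
Proof.
move=> i0; rewrite (_ : i = lshift n (@ord0 0)); last exact: val_inj.
by have := row_mxEl (\row_(_ < 1) s) v ord0 ord0; rewrite mxE.
Qed.

Lemma row_mx_lift (R : realType) n (s : R) (v : 'rV[R]_n) (j : 'I_n) :
  (row_mx (\row_(_ < 1) s) v : 'rV_n.+1) ord0 (lift ord0 j) = v ord0 j.
Proof.
rewrite (_ : lift ord0 j = rshift 1 j); last exact: val_inj.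
by have := row_mxEr (\row_(_ < 1) s) v ord0 j.
Qed.

Section iterated_integral.
Local Open Scope ereal_scope.
Variable R : realType.
Local Notation mu := (@lebesgue_measure R).

Lemma iint_ge0 n (f : 'rV[R]_n -> \bar R) : (forall v, 0 <= f v) -> 0 <= iint f.
Proof.
elim: n f => [|n IH] f f0 /=; first exact: f0.
by apply: integral_ge0 => s _; exact: IH.
Qed.

(** The parameter space is arbitrary so that the induction can absorb the outermost coordinate into
    it: the inner integral is measurable on [T * R], and Fubini-Tonelli gives measurability of its
    marginal. *)
Lemma measurable_iint n d (T : measurableType d)
    (f : T -> 'rV[R]_n -> \bar R) :
  (forall t v, 0 <= f t v) -> param_measurable f ->
  measurable_fun setT (fun t => iint (f t)).
Proof.
elim: n d T f => [|n IH] d T f f0 mf /=.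
  by apply: (mf _ _ id (fun=> 0%R)) => // -[].
apply: (@measurable_fun_fubini_tonelli_F _ _ _ _ _ mu
  (fun p : T * measurableTypeR R =>
     iint (fun v : 'rV_n => f p.1 (row_mx (\row_(_ < 1) p.2) v)))).
  apply: (IH _ _ (fun (p : T * measurableTypeR R) (v : 'rV[R]_n) => _)) => //.
  exact: param_measurable_row_mx.
by move=> p; exact: iint_ge0.
Qed.

Lemma measurable_iint_section n (f : 'rV[R]_n.+1 -> \bar R) :
  (forall v, 0 <= f v) -> vec_measurable f ->
  measurable_fun setT (fun s : measurableTypeR R =>
    iint (fun v : 'rV_n => f (row_mx (\row_(_ < 1) s) v))).
Proof.
by move=> f0 mf; apply: measurable_iint => //; exact: vec_measurable_row_mx.
Qed.

Lemma le_iint n (f g : 'rV[R]_n -> \bar R) :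
  (forall v, 0 <= f v) -> (forall v, 0 <= g v) ->
  vec_measurable f -> vec_measurable g ->
  (forall v, f v <= g v) -> iint f <= iint g.
Proof.
elim: n f g => [|n IH] f g f0 g0 mf mg fg /=; first exact: fg.
apply: ge0_le_integral => //=.
- by move=> s _; exact: iint_ge0.
- exact: measurable_iint_section.
- exact: measurable_iint_section.
- move=> s _; apply: IH => //.
  + by have := vec_measurable_row_mx mf => /(param_measurable_slice s).
  + by have := vec_measurable_row_mx mg => /(param_measurable_slice s).
Qed.

Lemma iintZl n (f : 'rV[R]_n -> \bar R) (k : R) :
  (forall v, 0 <= f v) -> vec_measurable f -> (0 <= k)%R ->
  iint (fun v => k%:E * f v) = k%:E * iint f.
Proof.
elim: n f => [|n IH] f f0 mf k0 //=.
rewrite -ge0_integralZl_EFin//.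
- apply: eq_integral => s _; rewrite IH//.
  by have := vec_measurable_row_mx mf => /(param_measurable_slice s).
- by move=> s _; exact: iint_ge0.
- exact: measurable_iint_section.
Qed.

(** The hyperplane where the first coordinate vanishes is a single point for the outermost integral,
    hence null. Measurability of the sections of [f] off that point is inherited from [g].
    Quantifying over indices of value 0 allows [n] to be [m + k], which is not syntactically a
    successor. *)
Lemma eq_iint_hyperplane n (f g : 'rV[R]_n -> \bar R) :
  (0 < n)%N ->
  (forall v : 'rV[R]_n,
    (forall i : 'I_n, val i = 0%N -> v ord0 i != 0%R) -> f v = g v) ->
  (forall v, 0 <= g v) -> vec_measurable g ->
  iint f = iint g.
Proof.
case: n f g => // n f g _ fg g0 mg /=.
rewrite -(@integral_setD1 _ _ 0%R setT)//=; last 2 first.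
- exact: measurableD.
- have := measurable_iint_section g0 mg => /measurable_funTS mG.
  apply: eq_measurable_fun (mG (setT `\ 0%R)) => s; rewrite inE /= => -[_ /eqP s0].
  congr iint; apply/funext => v; apply/esym/fg => i i0.
  by rewrite row_mx_first.
rewrite -[RHS](@integral_setD1 _ _ 0%R setT)//=; last 2 first.
- exact: measurableD.
- exact: measurable_funTS (measurable_iint_section g0 mg).
apply: eq_integral => s; rewrite inE /= => -[_ /eqP s0].
congr iint; apply/funext => v; apply/fg => i i0.
by rewrite row_mx_first.
Qed.

Lemma le_iint_hyperplane n (f g : 'rV[R]_n -> \bar R) :
  (0 < n)%N ->
  (forall v, 0 <= f v) -> (forall v, 0 <= g v) ->
  vec_measurable f -> vec_measurable g ->
  (forall v : 'rV[R]_n,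
    (forall i : 'I_n, val i = 0%N -> v ord0 i != 0%R) -> f v <= g v) ->
  iint f <= iint g.
Proof.
case: n f g => // n f g _ f0 g0 mf mg fg /=.
have mF := measurable_iint_section f0 mf.
have mG := measurable_iint_section g0 mg.
rewrite -(@integral_setD1 _ _ 0%R setT)//=; last 2 first.
- exact: measurableD.
- exact: measurable_funTS.
rewrite -[leRHS](@integral_setD1 _ _ 0%R setT)//=; last 2 first.
- exact: measurableD.
- exact: measurable_funTS.
apply: ge0_le_integral => //=.
- exact: measurableD.
- by move=> s _; exact: iint_ge0.
- exact: measurable_funTS.
- exact: measurable_funTS.
- move=> s [_ /eqP s0]; apply: le_iint => //.
  + by have := vec_measurable_row_mx mf => /(param_measurable_slice s).
  + by have := vec_measurable_row_mx mg => /(param_measurable_slice s).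
  + move=> v; apply: fg => i i0.
    by rewrite row_mx_first.
Qed.

(** The induction hypothesis moves the [s]-integral past the inner coordinates, and Tonelli on the
    plane moves it past the outermost one. *)
Lemma iint_tonelli n (f : measurableTypeR R -> 'rV[R]_n -> \bar R) :
  (forall s v, 0 <= f s v) -> param_measurable f ->
  iint (fun v => \int[mu]_s f s v) = \int[mu]_s iint (f s).
Proof.
elim: n f => [|n IH] f f0 mf //=.
transitivity (\int[mu]_r \int[mu]_s
    iint (fun v : 'rV_n => f s (row_mx (\row_(_ < 1) r) v))).
  apply: eq_integral => r _.
  rewrite (IH (fun s v => f s (row_mx (\row_(_ < 1) r) v)))//.
  move=> d' T' a v ma mv; apply: mf => //.
  exact: coord_measurable_row_mx.
have mg : measurable_fun setT (fun p : measurableTypeR R * measurableTypeR R =>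
    iint (fun v : 'rV_n => f p.1 (row_mx (\row_(_ < 1) p.2) v))).
  apply: (@measurable_iint _ _ _ (fun p v => _)) => //.
  exact: param_measurable_row_mx.
by have /= <- := fubini_tonelli (m1 := mu) (m2 := mu) _ mg
  (fun p => iint_ge0 (fun v => f0 _ _)).
Qed.

(** * Scaling of Lebesgue measure and of the iterated integral *)

Lemma lebesgue_integral_scale (f : R -> \bar R) (c : R) : (0 < c)%R ->
  measurable_fun setT (f : measurableTypeR R -> \bar R) -> (forall s, 0 <= f s) ->
  \int[mu]_s f (c * s)%R = (c^-1)%:E * \int[mu]_s f s.
Proof.
move=> c0 mf f0.
have ci : (0 <= c)%R by rewrite ltW.
have mc : measurable_fun setT
    (fun s : measurableTypeR R => (c * s)%R : measurableTypeR R).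
  exact: measurable_funM.
(* [c] times the pushforward under [s |-> c * s] gives each interval its length, so by uniqueness it
   is Lebesgue measure. *)
pose nu0 : {measure set (measurableTypeR R) -> \bar R} := mscale (NngNum ci)
  (pushforward mu (fun s : measurableTypeR R => (c * s)%R : measurableTypeR R)).
pose nu := nu0 mc.
have E : forall A, measurable A -> mu A = nu A.
  apply: lebesgue_measure_unique => _ [[a b]] _ <-.
  have -> : nu `]a, b]%classic =
      c%:E * mu `](c^-1 * a)%R, (c^-1 * b)%R]%classic.
    congr (_ * mu _); apply/seteqP; split => s /=; rewrite !in_itv/=;
      by rewrite ltr_pdivrMl// ler_pdivlMl.
  rewrite !lebesgue_measure_itv/= !lte_fin ltr_pM2l ?invr_gt0//.
  case: ifPn => _; last by rewrite mule0.
  by rewrite -!EFinD -EFinM mulrBr !mulVKf ?gt_eqF.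
have <- : \int[nu]_s f s = \int[mu]_s f s.
  by apply: eq_measure_integral => A mA _; apply/esym/E.
rewrite ge0_integral_mscale// ge0_integral_pushforward//.
by rewrite muleA -EFinM/= mulVf ?gt_eqF// mul1e preimage_setT.
Qed.

Lemma iint_scale n (f : 'rV[R]_n -> \bar R) (c : 'I_n -> R) :
  (forall i, 0 < c i)%R -> vec_measurable f -> (forall v, 0 <= f v) ->
  iint (fun v => f (\row_i (c i * v ord0 i)%R)) =
  ((\prod_i c i)^-1)%:E * iint f.
Proof.
elim: n f c => [|n IH] f c c0 mf f0 /=.
  by rewrite big_ord0 invr1 mul1e; congr f; apply/rowP => -[].
pose F (s : R) := iint (fun v : 'rV_n => f (row_mx (\row_(_ < 1) s) v)).
have F0 s : 0 <= F s by exact: iint_ge0.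
have mF : measurable_fun setT (F : measurableTypeR R -> _).
  exact: measurable_iint_section.
(* The induction hypothesis extracts the Jacobian of the inner coordinates; the factor [c ord0] then
   comes from the one-dimensional scaling. *)
transitivity (\int[mu]_s
    (((\prod_(i < n) c (lift ord0 i))^-1)%:E * F (c ord0 * s)%R)).
  apply: eq_integral => s _.
  rewrite -(IH (fun v => f (row_mx (\row_(_ < 1) (c ord0 * s)%R) v)))//.
    congr iint; apply/funext => v; congr f; apply/rowP => i.
    rewrite mxE.
    have [j ->|->] := unliftP ord0 i.
      by rewrite !row_mx_lift mxE.
    by rewrite !row_mx_first.
  by have := vec_measurable_row_mx mf => /(param_measurable_slice (c ord0 * s)%R).
have p0 : (0 < \prod_(i < n) c (lift ord0 i))%R by apply: prodr_gt0.
rewrite ge0_integralZl_EFin//; last 2 first.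
- apply: (measurableT_comp mF); exact: measurable_funM.
- by rewrite invr_ge0 ltW.
rewrite lebesgue_integral_scale// muleA -EFinM big_ord_recl.
by rewrite invfM mulrC.
Qed.

End iterated_integral.

(** * Hardy's inequality along an orbit *)

(** Young's inequality for the product of [a] and [b ^ (p - 1)] with exponents [p] and
    [p / (p - 1)], divided by [b ^ (p - 1)]. At [p = 1] the conjugate exponent is infinite, and the
    bound is an equality. *)
Lemma young_affine (R : realType) (a b p : R) : 0 <= a -> 0 < b -> 1 <= p ->
  a <= b `^ (1 - p) * (a `^ p / p) + (1 - p^-1) * b.
Proof.
move=> a0 b0; rewrite le_eqVlt => /predU1P[<-|p1].
  by rewrite subrr powRr0 mul1r powRr1// invr1 subrr mul0r addr0 mulr1.
have p0 : 0 < p by exact: lt_trans p1.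
have q0 : 0 < p - 1 by rewrite subr_gt0.
have h : a * b `^ (p - 1) <=
    a `^ p / p + (b `^ (p - 1)) `^ (p / (p - 1)) / (p / (p - 1)).
  apply: conjugate_powR => //; first exact: powR_ge0.
    by rewrite divr_gt0.
  by rewrite invf_div -[X in X + _]mul1r -mulrDl addrC subrK divff ?gt_eqF.
rewrite -powRrM (_ : (p - 1) * (p / (p - 1)) = p) in h; last first.
  by rewrite mulrCA divff ?mulr1// gt_eqF.
have e : b `^ (1 - p) * b `^ (p - 1) = 1.
  rewrite -powRD; last by rewrite (gt_eqF b0) implybT.
  by rewrite addrA subrK subrr powRr0.
rewrite -[leLHS]mulr1 -[X in _ * X <= _]e mulrCA.
apply: (le_trans (ler_wpM2l (powR_ge0 _ _) h)).
rewrite mulrDr lerD2l.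
have -> : (1 - p^-1) * b = b * ((p - 1) / p).
  by rewrite mulrC mulrBl divff ?mul1r// gt_eqF.
rewrite invf_div [leLHS]mulrA -powRD; last by rewrite (gt_eqF b0) implybT.
by rewrite subrK powRr1// ltW.
Qed.

(* Young's inequality is used with [b = |u 0| c e^(- c s)], whose integral over
   the half-line is [|u 0|]; the resulting term [(1 - 1/p) |u 0|] is absorbed by
   the left-hand side. *)
Lemma hardy_halfline (R : realType) (u du : R -> R) (c p S : R) :
  0 < c -> 1 <= p -> 0 < S ->
  (forall s : R, is_derive s (1 : R) u (du s)) -> continuous du -> u S = 0 ->
  ((`|u 0| `^ p)%:E <= (c `^ (- p))%:E *
    \int[lebesgue_measure]_s
      (exponential_pdf c s * (expR (c * p * s) * `|du s| `^ p))%:E)%E.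
Proof.
move=> c0 p1 S0 uE cdu uS.
have p0 : 0 < p by exact: lt_le_trans p1.
set X := (\int[_]_s _)%E.
have mdu : measurable_fun setT (du : measurableTypeR R -> measurableTypeR R).
  exact: continuous_measurable_fun.
have pdf0 s : 0 <= exponential_pdf c s by apply: exponential_pdf_ge0; exact: ltW.
have G0 s : 0 <= exponential_pdf c s * (expR (c * p * s) * `|du s| `^ p).
  by rewrite !mulr_ge0 ?expR_ge0 ?powR_ge0.
have mG : measurable_fun setT (fun s : measurableTypeR R =>
    exponential_pdf c s * (expR (c * p * s) * `|du s| `^ p)).
  apply: measurable_funM; first exact: measurable_exponential_pdf.
  apply: measurable_funM.
    by apply: measurableT_comp => //; exact: measurable_funM.
  apply: (measurableT_comp (measurable_powR _)).
  exact: (measurableT_comp (@normr_measurable _ setT)).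
have X0 : (0 <= X)%E by apply: integral_ge0 => s _; rewrite lee_fin.
(* The case [u 0 = 0] is set apart because Young's inequality needs [b > 0]. *)
have [u0|M0] := eqVneq (u 0) 0.
  by rewrite u0 normr0 powR0 ?gt_eqF// mule_ge0// lee_fin powR_ge0.
set M := `|u 0|.
have {}M0 : 0 < M by rewrite normr_gt0.
(* With [b = M c e^(- c s)], the two terms of [young_affine] are [A] times the integrand of [X] and
   [B] times the exponential density. *)
pose A := M `^ (1 - p) * c `^ (- p) / p.
have A0 : 0 <= A by rewrite !mulr_ge0 ?powR_ge0// invr_ge0 ltW.
pose B := (1 - p^-1) * M.
have B0 : 0 <= B by rewrite mulr_ge0 ?subr_ge0 ?invf_le1// ltW.
have FTC : (\int[lebesgue_measure]_(s in `[0%R, S]) (du s)%:E = - (u 0)%:E)%E.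
  rewrite (@continuous_FTC2 _ du u)//.
  - by rewrite uS add0e.
  - exact: continuous_subspaceT.
  - have cu : continuous u.
      by move=> s; apply: differentiable_continuous; apply/derivable1_diffP;
        case: (uE s).
    split; first by move=> s _; case: (uE s).
      exact: cvg_at_right_filter (cu _).
    exact: cvg_at_left_filter (cu _).
  - by move=> s _; rewrite derive1E; case: (uE s).
have step : (M%:E <= A%:E * X + B%:E)%E.
  have -> : M%:E = `|\int[lebesgue_measure]_(s in `[0%R, S]) (du s)%:E|%E.
    by rewrite FTC abseN.
  apply: (@le_trans _ _ (\int[lebesgue_measure]_(s in `[0%R, S]) `|(du s)%:E|)%E).
    apply: le_abse_integral => //; apply/measurable_EFinP.
    exact: measurable_funTS.
  pose H s := (A%:E * (exponential_pdf c s * (expR (c * p * s) * `|du s| `^ p))%:E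
     + B%:E * (exponential_pdf c s)%:E)%E.
  have m1 : measurable_fun setT (fun s : measurableTypeR R =>
     A%:E * (exponential_pdf c s * (expR (c * p * s) * `|du s| `^ p))%:E)%E.
    by apply: measurable_funeM; exact/measurable_EFinP.
  have m2 : measurable_fun setT (fun s : measurableTypeR R =>
     B%:E * (exponential_pdf c s)%:E)%E.
    apply: measurable_funeM; apply/measurable_EFinP.
    exact: measurable_exponential_pdf.
  have H0 s : (0 <= H s)%E by rewrite adde_ge0// mule_ge0// lee_fin.
  apply: (@le_trans _ _ (\int[lebesgue_measure]_(s in `[0%R, S]) H s)%E).
    apply: ge0_le_integral => //.
    - apply/measurable_EFinP; apply: (measurableT_comp (@normr_measurable _ setT)).
      exact: measurable_funTS.
    - exact/measurable_funTS/emeasurable_funD.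
    move=> s /=; rewrite in_itv/= => /andP[s0 sS].
    rewrite /H -!EFinM -EFinD lee_fin exponential_pdfE//.
    have eta0 : 0 < M * c * expR (- c * s) by rewrite !mulr_gt0 ?expR_gt0.
    apply: (le_trans (young_affine (normr_ge0 (du s)) eta0 p1)).
    rewrite le_eqVlt; apply/orP; left; apply/eqP; congr (_ + _); last first.
      by rewrite /B !mulrA.
    rewrite powRM ?mulr_ge0 ?expR_ge0 ?ltW// powRM ?ltW//.
    rewrite -[X in _ = X]mulrA.
    have -> : expR (- c * s) `^ (1 - p) = expR (- c * s) * expR (c * p * s).
      rewrite /powR gt_eqF ?expR_gt0// expRK -expRD; congr expR.
      by rewrite mulrBl mul1r mulNr mulrN opprK (mulrCA p) mulrA.
    have -> : c `^ (1 - p) = c * c `^ (- p).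
      rewrite powRD; last by rewrite (gt_eqF c0) implybT.
      by rewrite powRr1 ?ltW.
    rewrite /A; ring.
  (* Extending a nonnegative integrand to the whole line only increases the integral, and there the
     density has mass 1. *)
  apply: (@le_trans _ _ (\int[lebesgue_measure]_s H s)%E).
    by apply: ge0_subset_integral => //; exact: emeasurable_funD.
  rewrite ge0_integralD//.
  - rewrite ge0_integralZl_EFin//; last 2 first.
    + by move=> s _; rewrite lee_fin.
    + exact/measurable_EFinP.
    rewrite ge0_integralZl_EFin//; last 2 first.
    + by move=> s _; rewrite lee_fin.
    + by apply/measurable_EFinP; exact: measurable_exponential_pdf.
    by rewrite integral_exponential_pdf// mule1.
  - move=> s _. by rewrite mule_ge0// lee_fin.
  - by move=> s _; rewrite mule_ge0// lee_fin.
(* If [X] is infinite the claim is trivial. Otherwise everything is real, [B] can be subtracted to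
   leave [M / p], and multiplying by [M ^ (p - 1)] concludes. *)
case: X X0 step => [x x0|_ _|//]; last first.
  by rewrite gt0_muley ?leey// lte_fin powR_gt0.
rewrite -!EFinM -EFinD !lee_fin /A /B => h.
have {}h : M / p <= M `^ (1 - p) * c `^ (- p) / p * x.
  by move: h; rewrite mulrBl mul1r (mulrC p^-1) addrA lerBrDr addrC -lerBrDl addrC addrK.
have {}h : M <= M `^ (1 - p) * (c `^ (- p) * x).
  by move: h; rewrite mulrAC ler_pM2r ?invr_gt0// mulrA.
have -> : M `^ p = M * M `^ (p - 1).
  rewrite -[in X in X * _](powRr1 (ltW M0)) -powRD; last by rewrite (gt_eqF M0) implybT.
  by rewrite addrCA subrr addr0.
apply: (le_trans (ler_wpM2r (powR_ge0 _ _) h)).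
rewrite mulrAC -powRD; last by rewrite (gt_eqF M0) implybT.
by rewrite addrA subrK subrr powRr0 mul1r.
Qed.

(** * The chain rule for continuous partial derivatives *)

Lemma is_derive_line (R : realType) n (f : 'rV[R]_n -> R) (z v : 'rV[R]_n) (t : R) :
  derivable f (t *: v + z) v ->
  is_derive t 1 (fun s : R => f (s *: v + z)) ('D_v f (t *: v + z)).
Proof.
move=> df.
have E : (fun h : R => h^-1 *: (((fun s : R => f (s *: v + z)) \o shift t) (h *: 1) -
    f (t *: v + z))) =
   (fun h : R => h^-1 *: ((f \o shift (t *: v + z)) (h *: v) - f (t *: v + z))).
  apply/funext => h /=; congr (_ *: (f _ - _)).
  by rewrite addrA -scalerDl [_ *: 1]mulr1.
by split; rewrite /derivable /derive E.
Qed.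

(** The step [b] may have either sign; [|x| <= |b|] records how close the intermediate point stays
    to [z], so that it converges to [z] as [b] tends to 0. *)
Lemma mvt_line (R : realType) n (f : 'rV[R]_n -> R) (v : 'rV[R]_n) :
  (forall z, derivable f z v) ->
  forall z (b : R), exists x : R,
    `|x| <= `|b| /\ f (b *: v + z) - f z = b * 'D_v f (x *: v + z).
Proof.
move=> df z b.
pose g (s : R) := f (s *: v + z).
have dg (t : R) : is_derive t 1 g ('D_v f (t *: v + z)) by exact: is_derive_line.
have cg : continuous g.
  by move=> s; apply: differentiable_continuous; apply/derivable1_diffP;
    case: (dg s).
have g0 : f z = g 0 by rewrite /g scale0r add0r.
have [b0|b0] := leP 0 b.
- have [c cb e] := @MVT_segment R g (fun t => 'D_v f (t *: v + z)) 0 b b0 _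
    (continuous_subspaceT cg).
  exists c; move: cb; rewrite in_itv/= => /andP[c0 cb].
  by rewrite !ger0_norm// g0 [LHS]e subr0 mulrC.
- have [c cb e] := @MVT_segment R g (fun t => 'D_v f (t *: v + z)) b 0 (ltW b0) _
    (continuous_subspaceT cg).
  exists c; move: cb; rewrite in_itv/= => /andP[c0 cb].
  rewrite !ler0_norm ?(ltW b0)// lerN2; split => //.
  by rewrite g0 -opprB [X in - X]e sub0r mulrN opprK mulrC.
Qed.

Lemma cvg_coord_le (R : realType) n (F : set_system R) (FF : Filter F)
    (V : R -> 'rV[R]_n) (a : 'rV[R]_n) (b : 'I_n -> R -> R) :
  (forall j h, `|a ord0 j - V h ord0 j| <= `|b j h|) ->
  (forall j, b j h @[h --> F] --> (0 : R)) ->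
  V h @[h --> F] --> a.
Proof.
move=> Vb b0; apply/cvg_ballP => e e0; near=> h; split => // i j.
rewrite (ord1 i) /ball /=.
apply: (le_lt_trans (Vb j h)).
move: j; near: h; apply: filter_forall => j.
exact: cvgr0_norm_lt.
Unshelve. all: by end_near. Qed.

(* The increment of [f] along [g] is telescoped by moving one coordinate at a
   time, and the mean value theorem is applied to each move. *)
Lemma is_derive_curve (R : realType) n (f : 'rV[R]_n -> R) (g : R -> 'rV[R]_n)
    (dg : 'I_n -> R) (s : R) :
  (forall i z, derivable f z (evec R i)) ->
  (forall i, continuous (fun z => 'D_(evec R i) f z)) ->
  (forall i, is_derive s 1 (fun t => g t ord0 i) (dg i)) ->
  is_derive s 1 (fun t => f (g t)) (\sum_i dg i * 'D_(evec R i) f (g s)).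
Proof.
move=> df cf dgE.
(* [P i h] has its first [i] coordinates from [g (h + s)] and the others from [g s], so it runs from
   [g s] at [i = 0] to [g (h + s)] at [i = n]. *)
pose P (i : nat) h : 'rV[R]_n :=
  \row_j (if (j < i)%N then g (h + s) ord0 j else g s ord0 j).
pose b (i : 'I_n) h := g (h + s) ord0 i - g s ord0 i.
have PS (i : 'I_n) h : P i.+1 h = b i h *: evec R i + P i h.
  apply/rowP => j; rewrite !mxE eqxx /= ltnS.
  have [->|ij] := eqVneq j i; first by rewrite leqnn ltnn mulr1 subrK.
  by rewrite mulr0 add0r (leq_eqVlt j i) val_eqE (negbTE ij).
have [x xP] : exists x : 'I_n -> R -> R, forall i h, `|x i h| <= `|b i h| /\
   f (P i.+1 h) - f (P i h) = b i h * 'D_(evec R i) f (x i h *: evec R i + P i h).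
  have xE (i : 'I_n) : {x : R -> R & forall h, `|x h| <= `|b i h| /\
     f (P i.+1 h) - f (P i h) = b i h * 'D_(evec R i) f (x h *: evec R i + P i h)}.
    by apply: (choice (P := fun h y : R => `|y| <= `|b i h| /\
      f (P i.+1 h) - f (P i h) = b i h * 'D_(evec R i) f (y *: evec R i + P i h)))
      => h; rewrite PS; exact: mvt_line.
  by exists (fun i => projT1 (xE i)) => i h; case: (xE i).
have qb i : h^-1 * b i h @[h --> 0^'] --> dg i.
  have [d1 d2] := dgE i; rewrite -d2.
  rewrite (_ : (fun h => _) = (fun h =>
    h^-1 *: (((fun t => g t ord0 i) \o shift s) (h *: 1) - g s ord0 i))) //.
  by apply/funext => h /=; rewrite [h *: 1]mulr1.
(* The increment is [h] times the difference quotient, whose limit is finite. *)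
have b0 i : b i h @[h --> 0^'] --> (0 : R).
  have hc : h * (h^-1 * b i h) @[h --> (0:R)^'] --> 0 * dg i.
    apply: cvgM (qb i); exact: cvg_within.
  rewrite mul0r in hc; apply: (cvg_trans _ hc).
  apply: near_eq_cvg; near=> h.
  rewrite mulrA divff ?mul1r//; near: h; exact: nbhs_dnbhs_neq.
have cvgV i : x i h *: evec R i + P i h @[h --> 0^'] --> g s.
  apply: (@cvg_coord_le _ _ _ _ _ _ b) => // j h; rewrite !mxE eqxx /=.
  have [->|ij] := eqVneq j i.
    by rewrite ltnn mulr1 opprD addrCA subrr addr0 normrN; case: (xP i h).
  rewrite mulr0 add0r; case: ifPn => _; last by rewrite subrr normr0.
  by rewrite distrC.
have main : h^-1 *: (f (g (h + s)) - f (g s)) @[h --> 0^'] -->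
    \sum_i dg i * 'D_(evec R i) f (g s).
  rewrite (_ : (fun h => _) = \sum_(i < n)
     (fun h => (h^-1 * b i h) * 'D_(evec R i) f (x i h *: evec R i + P i h))).
    elim/big_ind2 : _ => [|*|i _]; [exact: cvg_cst|exact: cvgD|].
    apply: cvgM; first exact: qb.
    exact: (cvg_comp _ _ (cvgV i) (cf i (g s))).
  apply/funext => h; rewrite fct_sumE.
  have -> : g (h + s) = P n h by apply/rowP => j; rewrite mxE ltn_ord.
  have -> : g s = P 0%N h by apply/rowP => j; rewrite mxE.
  rewrite -(telescope_sumr (fun i => f (P i h)) (leq0n n)) big_mkord scaler_sumr.
  by apply: eq_bigr => i _; rewrite (xP i h).2 [LHS]mulrA.
have E : (fun h : R => h^-1 *: (((fun t => f (g t)) \o shift s) (h *: 1) - f (g s)))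
    = (fun h : R => h^-1 *: (f (g (h + s)) - f (g s))).
  by apply/funext => h /=; rewrite [h *: 1]mulr1.
split; first by rewrite /derivable E; apply/cvg_ex; eexists; exact: main.
by rewrite /derive E; exact/cvg_lim.
Unshelve. all: by end_near. Qed.

(** * Hardy's inequality for a homogeneous weight *)

Section dilation.
Variables (R : realType) (n : nat) (w : 'I_n -> R).

Definition dilation (s : R) (z : 'rV[R]_n) : 'rV[R]_n :=
  \row_i (expR (w i * s) * z ord0 i).

Definition euler_field (f : 'rV[R]_n -> R) (z : 'rV[R]_n) : R :=
  \sum_i w i * z ord0 i * 'D_(evec R i) f z.

Lemma dilation0 z : dilation 0 z = z.
Proof. by apply/rowP => i; rewrite mxE mulr0 expR0 mul1r. Qed.

Lemma continuous_dilation z : continuous (fun s => dilation s z).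
Proof.
move=> s; apply: (@cvg_coord_le _ _ _ _ _ _
  (fun j h => dilation s z ord0 j - dilation h z ord0 j)) => // j.
have : dilation s z ord0 j - dilation h z ord0 j @[h --> s] -->
    dilation s z ord0 j - dilation s z ord0 j.
  apply: cvgB; first exact: cvg_cst.
  under eq_fun do rewrite mxE. rewrite mxE.
  apply: cvgMr_tmp; apply: continuous_comp; last exact: continuous_expR.
  by apply: cvgMl_tmp; exact: cvg_id.
by rewrite subrr.
Qed.

Lemma is_derive_dilation (f : 'rV[R]_n -> R) (z : 'rV[R]_n) (s : R) :
  (forall i z, derivable f z (evec R i)) ->
  (forall i, continuous (fun z => 'D_(evec R i) f z)) ->
  is_derive s 1 (fun t => f (dilation t z)) (euler_field f (dilation s z)).
Proof.
move=> df cf.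
apply: (@is_derive_curve _ _ f (fun t => dilation t z)
  (fun i => w i * dilation s z ord0 i) s df cf) => i.
under eq_fun do rewrite mxE.
rewrite mxE.
apply: is_derive_eq.
by rewrite /= !scaler0 ?add0r ?addr0 /GRing.scale /=; ring.
Qed.

Lemma continuous_euler_field (f : 'rV[R]_n -> R) :
  (forall i, continuous (fun z => 'D_(evec R i) f z)) ->
  continuous (euler_field f).
Proof.
move=> cf z.
have -> : euler_field f =
    \sum_i (fun z : 'rV[R]_n => w i * z ord0 i * 'D_(evec R i) f z).
  by apply/funext => x; rewrite fct_sumE.
elim/big_ind : _ => [|g h cg ch|i _].
- exact: cst_continuous.
- exact: continuousD.
- have ci : continuous (fun x : 'rV[R]_n => x ord0 i) by exact: coord_continuous.
  exact: (cvgM (cvgM (cvg_cst _) (ci z)) (cf i z)).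
Qed.

Lemma dilation_escapes (M : R) (z : 'rV[R]_n) (i : 'I_n) :
  0 < w i -> z ord0 i != 0 -> exists2 S : R, 0 < S & M < `|dilation S z ord0 i|.
Proof.
move=> wi zi; have z0 : 0 < `|z ord0 i| by rewrite normr_gt0.
(* By [e^x >= 1 + x], this [S] stretches [|z_i|] to at least [|M| + 2 |z_i|]; the added 1 also keeps
   [S] positive when [M = 0]. *)
exists ((`|M| / `|z ord0 i| + 1) / w i).
  by rewrite divr_gt0// ltr_wpDl// divr_ge0.
rewrite mxE normrM gtr0_norm ?expR_gt0// mulrCA divff ?gt_eqF// mulr1.
apply: (le_lt_trans (ler_norm M)).
rewrite -ltr_pdivrMr//; apply: lt_le_trans (expR_ge1Dx _).
by rewrite addrCA ltrDl addr_gt0.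
Qed.

End dilation.

Theorem dilation_hardy (R : realType) n (w : 'I_n -> R)
    (phi W : 'rV[R]_n -> R) (beta p M : R) :
  (0 < n)%N -> (forall i, 0 < w i) ->
  (forall i z, derivable phi z (evec R i)) ->
  (forall i, continuous (fun z => 'D_(evec R i) phi z)) ->
  continuous phi ->
  (forall z, phi z != 0 -> forall i, `|z ord0 i| <= M) ->
  vec_measurable (W : _ -> measurableTypeR R) -> (forall z, 0 <= W z) ->
  (forall s z, W (dilation w s z) = expR (beta * s) * W z) ->
  1 <= p -> 0 < \sum_i w i + beta ->
  ((((\sum_i w i + beta) / p) `^ p)%:E * iint (fun z => (W z * `|phi z| `^ p)%:E)
   <= iint (fun z => (W z * `|euler_field w phi z| `^ p)%:E))%E.
Proof.
move=> n0 w0 dphi cdphi cphi supp mW W0 Wh p1 Q0.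
have p0 : 0 < p by exact: lt_le_trans p1.
set c := _ / p; have c0 : 0 < c by rewrite divr_gt0.
(* The rate [c] is dictated by this identity: [e^(c p s)] must be the Jacobian of the dilation times
   the homogeneity factor of [W]. *)
have cp : c * p = \sum_i w i + beta by rewrite divfK// gt_eqF.
pose H z := W z * `|euler_field w phi z| `^ p.
have H0 z : 0 <= H z by rewrite mulr_ge0 ?powR_ge0.
have meuler := continuous_vec_measurable (@continuous_euler_field _ _ w _ cdphi).
have mphi := continuous_vec_measurable cphi.
have mH : vec_measurable (fun z => (H z)%:E).
  move=> d T v mv; apply/measurable_EFinP; apply: measurable_funM; first exact: mW.
  apply: (measurableT_comp (measurable_powR _)).
  by apply: (measurableT_comp (@normr_measurable _ setT)); exact: meuler.
pose G s z := exponential_pdf c s *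
  (expR (c * p * s) * `|euler_field w phi (dilation w s z)| `^ p).
have pdf0 s : 0 <= exponential_pdf c s by apply: exponential_pdf_ge0; exact: ltW.
have G0 s z : 0 <= G s z by rewrite !mulr_ge0 ?expR_ge0 ?powR_ge0.
pose F (s : measurableTypeR R) z := ((c `^ (- p))%:E * (W z * G s z)%:E)%E.
have F0 s z : (0 <= F s z)%E.
  by rewrite mule_ge0// lee_fin ?powR_ge0// mulr_ge0.
have mG : param_measurable (fun (s : measurableTypeR R) z => G s z : measurableTypeR R).
  move=> d T a v ma mv; apply: measurable_funM.
    exact: (measurableT_comp (measurable_exponential_pdf _)).
  apply: measurable_funM.
    by apply: measurableT_comp => //; exact: measurable_funM.
  apply: (measurableT_comp (measurable_powR _)).
  apply: (measurableT_comp (@normr_measurable _ setT)); apply: meuler => i.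
  under eq_fun do rewrite mxE.
  apply: measurable_funM; last exact: mv.
  by apply: measurableT_comp => //; exact: measurable_funM.
have mWG : param_measurable (fun (s : measurableTypeR R) z => (W z * G s z)%:E).
  move=> d T a v ma mv; apply/measurable_EFinP; apply: measurable_funM.
    exact: mW.
  exact: mG.
have mF : param_measurable F.
  by move=> d T a v ma mv; apply: measurable_funeM; exact: mWG.
(* Off the null hyperplane the first coordinate grows along the orbit past [M], so [phi] vanishes at
   some time [S] and the half-line inequality applies. *)
have pw (z : 'rV[R]_n) : (forall i : 'I_n, val i = 0%N -> z ord0 i != 0) ->
    ((W z * `|phi z| `^ p)%:E <= \int[lebesgue_measure]_s F s z)%E.
  move=> z0.
  have [S S0 MS] := dilation_escapes M (w0 (Ordinal n0)) (z0 (Ordinal n0) erefl).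
  have uS : phi (dilation w S z) = 0.
    apply/eqP; apply: contraTT MS => /supp/(_ (Ordinal n0)).
    by rewrite leNgt.
  have cdu : continuous (fun s => euler_field w phi (dilation w s z)).
    move=> s; apply: (continuous_comp (@continuous_dilation _ _ w z s)).
    exact: continuous_euler_field.
  have := hardy_halfline c0 p1 S0
    (fun s => @is_derive_dilation _ _ w _ z s dphi cdphi) cdu uS.
  rewrite dilation0 => h.
  have mGz : measurable_fun setT (fun s : measurableTypeR R => (G s z)%:E).
    apply/measurable_EFinP; apply: (mG _ _ id (fun=> z)) => // i.
  have {}h := lee_wpmul2l (_ : (0 <= (W z)%:E)%E) h.
  rewrite EFinM; apply: le_trans (h _) _; first by rewrite lee_fin.
  rewrite muleCA -ge0_integralZl_EFin//; last by move=> s _; rewrite lee_fin; exact: G0.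
  rewrite /F [leRHS]ge0_integralZl_EFin//; last 3 first.
  - by move=> s _; rewrite lee_fin mulr_ge0.
  - by apply: (mWG _ _ id (fun=> z)) => // i.
  - exact: powR_ge0.
set I := iint _; set J := iint _.
have J0 : (0 <= J)%E by apply: iint_ge0 => z; rewrite lee_fin; exact: H0.
have IJ : (I <= (c `^ (- p))%:E * J)%E.
  apply: (@le_trans _ _ (iint (fun z => \int[lebesgue_measure]_s F s z)%E)).
    apply: le_iint_hyperplane => //.
    - by move=> z; rewrite lee_fin mulr_ge0 ?powR_ge0.
    - by move=> z; apply: integral_ge0 => s _.
    - move=> d T v mv; apply/measurable_EFinP; apply: measurable_funM; first exact: mW.
      apply: (measurableT_comp (measurable_powR _)).
      by apply: (measurableT_comp (@normr_measurable _ setT)); exact: mphi.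
    - move=> d T v mv.
      apply: (@measurable_fun_fubini_tonelli_F _ _ _ _ _ lebesgue_measure
        (fun q : T * measurableTypeR R => F q.2 (v q.1))) => //.
      apply: mF; first exact: measurable_snd.
      by move=> i; apply: (measurableT_comp (mv i)); exact: measurable_fst.
  rewrite iint_tonelli//.
  (* After Tonelli, the spatial integral at time [s] is a multiple of [J] whose only dependence on
     [s] is the exponential density. *)
  rewrite (eq_integral (fun s : measurableTypeR R =>
    ((c `^ (- p))%:E * J) * (exponential_pdf c s)%:E)%E); last first.
    move=> s _; rewrite /F iintZl//; last 3 first.
    - by move=> z; rewrite lee_fin mulr_ge0.
    - exact: (param_measurable_slice s mWG).
    - exact: powR_ge0.
    rewrite -muleA; congr (_ * _)%E.
    (* Moving [W] to the dilated point costs [e^(- beta s)]; what remains of [e^(c p s)] is the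
       Jacobian, cancelled by [iint_scale]. *)
    have E z : ((W z * G s z)%:E =
        (exponential_pdf c s * expR ((\sum_i w i) * s))%:E * (H (dilation w s z))%:E)%E.
      rewrite -EFinM; congr (_%:E).
      rewrite /G /H Wh cp mulrDl expRD; ring.
    rewrite (funext E).
    rewrite (iintZl (f := fun z => (H (dilation w s z))%:E)); first last.
    - by rewrite mulr_ge0 ?expR_ge0.
    - move=> d T v mv; apply: mH => i.
      under eq_fun do rewrite mxE.
      by apply: measurable_funM => //; exact: mv.
    - by move=> z; rewrite lee_fin.
    have -> := iint_scale (f := fun z => (H z)%:E) (c := fun i => expR (w i * s))
      (fun i => expR_gt0 _) mH (fun z => H0 z).
    rewrite -expR_sum -mulr_suml muleA -EFinM -mulrA divff ?mulr1; last first.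
      by rewrite gt_eqF ?expR_gt0.
    by rewrite muleC.
  rewrite ge0_integralZl//.
  - by rewrite integral_exponential_pdf// mule1.
  - by apply/measurable_EFinP; exact: measurable_exponential_pdf.
  - by move=> s _; rewrite lee_fin.
  - by rewrite mule_ge0// lee_fin powR_ge0.
apply: le_trans (lee_wpmul2l _ IJ) _; first by rewrite lee_fin powR_ge0.
rewrite muleA -EFinM -powRD; last by rewrite (gt_eqF c0) implybT.
by rewrite subrr powRr0 mul1e.
Qed.

(** * The Grushin gauge *)

(** The gauge is differentiated through squared norms, which are quadratic polynomials along
    lines. *)
Definition sqnorm (R : realType) n (v : 'rV[R]_n) : R := \sum_i v ord0 i ^+ 2.

Lemma sqnorm_ge0 (R : realType) n (v : 'rV[R]_n) : 0 <= sqnorm v.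
Proof. by apply: sumr_ge0 => i _; rewrite sqr_ge0. Qed.

Lemma sqnorm_gt0 (R : realType) n (v : 'rV[R]_n) i :
  v ord0 i != 0 -> 0 < sqnorm v.
Proof.
move=> vi; rewrite /sqnorm (bigD1 i)//= ltr_pwDl ?exprn_even_gt0//.
by apply: sumr_ge0 => j _; rewrite sqr_ge0.
Qed.

Lemma enorm_ge0 (R : realType) n (v : 'rV[R]_n) : 0 <= enorm v.
Proof. exact: sqrtr_ge0. Qed.

Lemma sqr_enorm (R : realType) n (v : 'rV[R]_n) : enorm v ^+ 2 = sqnorm v.
Proof. by rewrite sqr_sqrtr// sqnorm_ge0. Qed.

Lemma enorm_powR2 (R : realType) n (v : 'rV[R]_n) (r : R) :
  enorm v `^ (2 * r) = sqnorm v `^ r.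
Proof. by rewrite powRrM powR_mulrn ?enorm_ge0// sqr_enorm. Qed.

Lemma sqnorm_line (R : realType) n (h : R) (u v : 'rV[R]_n) :
  sqnorm (h *: u + v) =
  sqnorm v + 2 * (\sum_i u ord0 i * v ord0 i) * h + sqnorm u * h ^+ 2.
Proof.
rewrite /sqnorm mulr_sumr !mulr_suml -!big_split /=; apply: eq_bigr => i _.
by rewrite !mxE; ring.
Qed.

(** Expanding the sum of [(B a_i - C b_i)^2] gives [B (A B - C^2) >= 0]; if [B = 0], every [b_i]
    vanishes. *)
Lemma cauchy_schwarz (R : realType) n (a b : 'I_n -> R) :
  (\sum_i a i * b i) ^+ 2 <= (\sum_i a i ^+ 2) * (\sum_i b i ^+ 2).
Proof.
set A := \sum_i a i ^+ 2; set B := \sum_i b i ^+ 2; set C := \sum_i _.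
have A0 : 0 <= A by apply: sumr_ge0 => i _; exact: sqr_ge0.
have B0 : 0 <= B by apply: sumr_ge0 => i _; exact: sqr_ge0.
have h : 0 <= B * (A * B - C ^+ 2).
  have <- : \sum_i (B * a i - C * b i) ^+ 2 = B * (A * B - C ^+ 2).
    have -> : \sum_i (B * a i - C * b i) ^+ 2 =
        \sum_i (B ^+ 2 * a i ^+ 2 + (- (2 * B * C)) * (a i * b i) + C ^+ 2 * b i ^+ 2).
      by apply: eq_bigr => i _; ring.
    rewrite !big_split /= -!mulr_sumr -/A -/B -/C; ring.
  by apply: sumr_ge0 => i _; exact: sqr_ge0.
have [B0'|B0'] := eqVneq B 0; last first.
  by move: h; rewrite pmulr_rge0 ?subr_ge0// lt_def B0' B0.
have b0 i : b i = 0.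
  apply/eqP; rewrite -sqrf_eq0.
  by rewrite (psumr_eq0P (fun i _ => sqr_ge0 (b i)) B0').
by rewrite B0' mulr0 /C big1 ?expr0n// => i _; rewrite b0 mulr0.
Qed.

(** This is the shape of the gauge on a line; [a0 > 0] keeps the bases of both powers positive at 0,
    where real powers are differentiable. *)
Lemma is_derive_gauge_line (R : realType) (a0 a1 a2 b0 b1 b2 r q : R) :
  0 < a0 -> 0 <= b0 ->
  is_derive (0 : R) 1
    (fun h : R => ((a0 + a1 * h + a2 * h ^+ 2) `^ r + (b0 + b1 * h + b2 * h ^+ 2)) `^ q)
    (q * (a0 `^ r + b0) `^ (q - 1) * (r * a0 `^ (r - 1) * a1 + b1)).
Proof.
move=> a00 b00.
pose f1 (h : R) := a0 + a1 * h + a2 * h ^+ 2.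
pose f2 (h : R) := b0 + b1 * h + b2 * h ^+ 2.
have quad (c0 c1 c2 : R) :
    is_derive (0 : R) 1 (fun h : R => c0 + c1 * h + c2 * h ^+ 2) c1.
  have -> : (fun h : R => c0 + c1 * h + c2 * h ^+ 2) =
     horner (c0%:P + c1 *: 'X + c2 *: 'X^2).
    by apply/funext => h; rewrite !hornerE.
  by apply: is_derive_eq; rewrite !derivD derivC !derivZ derivX derivXn !hornerE /=; ring.
have d1 : is_derive (0 : R) 1 f1 a1 by exact: quad.
have d2 : is_derive (0 : R) 1 f2 b1 by exact: quad.
have f10 : f1 0 = a0 by rewrite /f1 expr0n !mulr0 !addr0.
have f20 : f2 0 = b0 by rewrite /f2 expr0n !mulr0 !addr0.
have d3 : is_derive (0 : R) 1 ((fun x => x `^ r) \o f1) (r * a0 `^ (r - 1) * a1).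
  by apply: is_derive1_comp; rewrite f10; exact: is_derive1_powR.
have d4 := is_deriveD d3 d2.
have : is_derive (0 : R) 1 ((fun x => x `^ q) \o (((fun x => x `^ r) \o f1) + f2))
    (q * (a0 `^ r + b0) `^ (q - 1) * (r * a0 `^ (r - 1) * a1 + b1)).
  apply: is_derive1_comp.
  have -> : (((fun x => x `^ r) \o f1) + f2) 0 = a0 `^ r + b0.
    by rewrite -[LHS]/(f1 0 `^ r + f2 0) f10 f20.
  by apply: is_derive1_powR; rewrite ltr_pwDl// powR_gt0.
by [].
Qed.

Lemma derive_line0 (R : realType) n (f : 'rV[R]_n -> R) (z v : 'rV[R]_n) (d : R) :
  is_derive (0 : R) 1 (fun h : R => f (h *: v + z)) d -> 'D_v f z = d.
Proof.
move=> [_ <-]; rewrite /derive.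
suff -> : (fun h : R => h^-1 *: ((f \o shift z) (h *: v) - f z)) =
  (fun h : R => h^-1 *: (((fun t : R => f (t *: v + z)) \o shift 0) (h *: 1)
     - f (0 *: v + z))) by [].
by apply/funext => h /=; rewrite addr0 scale0r add0r [h *: 1]mulr1.
Qed.

Section gauge.
Variables (R : realType) (m k : nat) (gamma : R).
Hypothesis gamma0 : 0 < gamma.
Local Notation rho := (gauge m k gamma).
Implicit Types z v : 'rV[R]_(m + k).

Let e0 : 0 < 1 + gamma. Proof. by rewrite addr_gt0. Qed.

Definition gauge_base z : R :=
  sqnorm (xpart z) `^ (1 + gamma) + (1 + gamma) ^+ 2 * sqnorm (ypart z).

Lemma gaugeE z : rho z = gauge_base z `^ (1 / (2 * (1 + gamma))).
Proof. by rewrite /gauge enorm_powR2 sqr_enorm. Qed.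

Lemma gauge_base_gt0 z : 0 < sqnorm (xpart z) -> 0 < gauge_base z.
Proof.
by move=> x0; rewrite ltr_pwDl ?powR_gt0// mulr_ge0 ?sqr_ge0 ?sqnorm_ge0.
Qed.

Lemma derive_gauge z v : 0 < sqnorm (xpart z) ->
  'D_v rho z = gauge_base z `^ (1 / (2 * (1 + gamma)) - 1) *
    (sqnorm (xpart z) `^ gamma * (\sum_i xpart v ord0 i * xpart z ord0 i) +
     (1 + gamma) * (\sum_j ypart v ord0 j * ypart z ord0 j)).
Proof.
move=> x0; set sx := \sum_i xpart v _ _ * _; set sy := \sum_j _.
apply: derive_line0.
have -> : (fun h : R => rho (h *: v + z)) = (fun h : R =>
   ((sqnorm (xpart z) + (2 * sx) * h + sqnorm (xpart v) * h ^+ 2) `^ (1 + gamma) +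
    ((1 + gamma) ^+ 2 * sqnorm (ypart z) + ((1 + gamma) ^+ 2 * (2 * sy)) * h
      + (1 + gamma) ^+ 2 * sqnorm (ypart v) * h ^+ 2)) `^ (1 / (2 * (1 + gamma)))).
  apply/funext => h; rewrite gaugeE /gauge_base.
  rewrite /xpart /ypart !linearD !linearZ /= !sqnorm_line.
  by congr ((_ + _) `^ _); rewrite /sy /ypart; ring.
apply: is_derive_eq.
  apply: is_derive_gauge_line => //.
  by rewrite mulr_ge0 ?sqr_ge0 ?sqnorm_ge0.
rewrite -/(gauge_base z) (addrC 1 gamma) addrK.
have : gamma + 1 != 0 by rewrite addrC gt_eqF.
by move=> ?; field.
Qed.

(** With [D = gauge_base z], the squared partials add up to [D^(2 (q - 1)) |x|^(2 gamma) D]: the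
    bracket reproduces [D] itself. The exponent [q - 1 + 1/2] then equals [- gamma q]. *)
Lemma gauge_gradE z : 0 < sqnorm (xpart z) ->
  grushin_grad_norm m k gamma rho z =
  enorm (xpart z) `^ gamma / rho z `^ gamma.
Proof.
move=> x0; have D0 := gauge_base_gt0 x0.
set X := enorm (xpart z) `^ gamma; set a := sqnorm (xpart z).
have X0 : 0 <= X by exact: powR_ge0.
have X2 : X ^+ 2 = a `^ gamma.
  by rewrite -powR_mulrn// -powRrM mulrC enorm_powR2.
set q := 1 / (2 * (1 + gamma)).
have hx (i : 'I_m) : 'D_(evec R (lshift k i)) rho z =
    gauge_base z `^ (q - 1) * (a `^ gamma * xpart z ord0 i).
  rewrite derive_gauge//; congr (_ * _).
  rewrite [X in _ * X + _](bigD1 i)//= !big1 ?mulr0 ?addr0.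
  - by rewrite /xpart !mxE !eqxx mul1r.
  - by move=> j _; rewrite /ypart !mxE eq_rlshift andbF mul0r.
  - move=> j ji; rewrite /xpart !mxE eq_lshift (negbTE ji) andbF.
    by rewrite mul0r.
have hy (j : 'I_k) : 'D_(evec R (rshift m j)) rho z =
    gauge_base z `^ (q - 1) * ((1 + gamma) * ypart z ord0 j).
  rewrite derive_gauge//; congr (_ * _).
  rewrite [X in _ + _ * X](bigD1 j)//= !big1 ?mulr0 ?add0r ?addr0.
  - by rewrite /ypart !mxE !eqxx mul1r.
  - move=> i ij; rewrite /ypart !mxE eq_rshift (negbTE ij) andbF.
    by rewrite mul0r.
  - by move=> i _; rewrite /xpart !mxE eq_lrshift andbF mul0r.
rewrite /grushin_grad_norm.
under eq_bigr do rewrite hx.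
under [X in _ + X]eq_bigr do rewrite hy.
rewrite -/X.
have -> : \sum_(i < m) (gauge_base z `^ (q - 1) * (a `^ gamma * xpart z ord0 i)) ^+ 2 +
   \sum_(j < k) (X * (gauge_base z `^ (q - 1) * ((1 + gamma) * ypart z ord0 j))) ^+ 2
  = (gauge_base z `^ (q - 1)) ^+ 2 * a `^ gamma *
    (a `^ gamma * a + (1 + gamma) ^+ 2 * sqnorm (ypart z)).
  rewrite mulrDr {4}/a /sqnorm !mulr_sumr; congr (_ + _); apply: eq_bigr => i _.
    by ring.
  by rewrite -X2; ring.
have -> : a `^ gamma * a = a `^ (1 + gamma).
  rewrite powRD; last by rewrite (gt_eqF x0) implybT.
  by rewrite powRr1 ?ltW// mulrC.
rewrite -/(gauge_base z) -X2.
have -> : (gauge_base z `^ (q - 1)) ^+ 2 * X ^+ 2 * gauge_base z =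
   (X * (gauge_base z `^ (q - 1) * gauge_base z `^ (1/2))) ^+ 2.
  rewrite !exprMn mulrA (mulrC (X ^+ 2)); congr (_ * _).
  by rewrite -(powR_mulrn 2 (powR_ge0 _ _)) -powRrM mul1r mulVf ?powRr1// ltW.
rewrite sqrtr_sqr ger0_norm; last by rewrite !mulr_ge0 ?powR_ge0.
congr (_ * _); rewrite gaugeE -powRrM -powRN -powRD; last first.
  by rewrite (gt_eqF D0) implybT.
congr (_ `^ _); rewrite /q.
have : 1 + gamma != 0 by rewrite gt_eqF.
by move=> ?; field.
Qed.

Definition grushin_weight (i : 'I_(m + k)) : R :=
  if fintype.split i is inl _ then 1 else 1 + gamma.

Lemma grushin_weight_l i : grushin_weight (lshift k i) = 1.
Proof. by rewrite /grushin_weight (unsplitK (inl _ i)). Qed.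

Lemma grushin_weight_r j : grushin_weight (rshift m j) = 1 + gamma.
Proof. by rewrite /grushin_weight (unsplitK (inr _ j)). Qed.

Lemma grushin_weight_gt0 i : 0 < grushin_weight i.
Proof. by rewrite /grushin_weight; case: (fintype.split i). Qed.

Lemma sum_grushin_weight : \sum_i grushin_weight i = hom_dim m k gamma.
Proof.
rewrite big_split_ord /= /hom_dim.
under eq_bigr do rewrite grushin_weight_l.
under [X in _ + X]eq_bigr do rewrite grushin_weight_r.
by rewrite !sumr_const !card_ord mulr_natr.
Qed.

Lemma xpart_dilation s z :
  enorm (xpart (dilation grushin_weight s z)) = expR s * enorm (xpart z).
Proof.
rewrite /enorm -[X in X * _]ger0_norm ?expR_ge0// -sqrtr_sqr -sqrtrM ?sqr_ge0//.
rewrite mulr_sumr; congr Num.sqrt; apply: eq_bigr => i _.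
by rewrite !mxE grushin_weight_l mul1r exprMn.
Qed.

Lemma ypart_dilation s z :
  enorm (ypart (dilation grushin_weight s z)) =
  expR ((1 + gamma) * s) * enorm (ypart z).
Proof.
rewrite /enorm -[X in X * _]ger0_norm ?expR_ge0// -sqrtr_sqr -sqrtrM ?sqr_ge0//.
rewrite mulr_sumr; congr Num.sqrt; apply: eq_bigr => i _.
by rewrite !mxE grushin_weight_r exprMn.
Qed.

Lemma expR_powR (a b : R) : expR a `^ b = expR (a * b).
Proof. by rewrite /powR gt_eqF ?expR_gt0// expRK mulrC. Qed.

(** Both terms under the root scale by [e^(2 (1 + gamma) s)]. *)
Lemma gauge_dilation s z :
  rho (dilation grushin_weight s z) = expR s * rho z.
Proof.
rewrite /gauge xpart_dilation ypart_dilation powRM ?expR_ge0 ?enorm_ge0//.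
rewrite exprMn -[X in (1 + gamma) ^+ 2 * (X * _)]expRM_natl expR_powR.
rewrite (_ : 2 * ((1 + gamma) * s) = s * (2 * (1 + gamma))); last by ring.
rewrite [X in _ + X]mulrCA -mulrDr powRM ?expR_ge0//; last first.
  by rewrite addr_ge0 ?powR_ge0// mulr_ge0 ?sqr_ge0.
rewrite expR_powR; congr (expR _ * _).
have : 1 + gamma != 0 by rewrite gt_eqF.
by move=> ?; field.
Qed.

(** Cauchy-Schwarz after splitting each term of the Euler field as [(w_i z_i / v_i) (v_i d_i f)].
    The second vector has length [|grad f|]; the first has squared length [|x|^2 + (1 + gamma)^2
    |y|^2 / |x|^(2 gamma)], which is [rho^(2 (1 + gamma)) / |x|^(2 gamma)]. *)
Lemma euler_field_le f z : 0 < sqnorm (xpart z) ->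
  enorm (xpart z) `^ gamma / rho z `^ gamma / rho z *
    `|euler_field grushin_weight f z| <= grushin_grad_norm m k gamma f z.
Proof.
move=> x0; have D0 := gauge_base_gt0 x0.
have n0 : 0 < enorm (xpart z) by rewrite sqrtr_gt0.
set X := enorm (xpart z) `^ gamma.
have X0 : 0 < X by exact: powR_gt0.
(* The coefficients of the Grushin gradient, nonzero because [x] is. *)
pose v (i : 'I_(m + k)) := if fintype.split i is inl _ then 1 else X.
have vl i : v (lshift k i) = 1 by rewrite /v (unsplitK (inl _ i)).
have vr i : v (rshift m i) = X by rewrite /v (unsplitK (inr _ i)).
have v0 i : v i != 0 by rewrite /v; case: (fintype.split i) => _; rewrite ?oner_eq0 ?gt_eqF.
have r0 : 0 < rho z by rewrite gaugeE powR_gt0.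
have E : euler_field grushin_weight f z =
   \sum_i (grushin_weight i * z ord0 i / v i) * (v i * 'D_(evec R i) f z).
  by apply: eq_bigr => i _; rewrite mulrA divfK.
have S2 : grushin_grad_norm m k gamma f z ^+ 2 = \sum_i (v i * 'D_(evec R i) f z) ^+ 2.
  rewrite sqr_sqrtr; last first.
    by rewrite addr_ge0// sumr_ge0// => i _; exact: sqr_ge0.
  rewrite big_split_ord /=; congr (_ + _); apply: eq_bigr => i _.
    by rewrite vl mul1r.
  by rewrite vr.
have X2 : X ^+ 2 = sqnorm (xpart z) `^ gamma.
  by rewrite -powR_mulrn ?ltW// -powRrM mulrC enorm_powR2.
have S1 : \sum_i (grushin_weight i * z ord0 i / v i) ^+ 2 = gauge_base z / X ^+ 2.
  rewrite big_split_ord /= /gauge_base mulrDl; congr (_ + _).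
    rewrite powRD; last by rewrite (gt_eqF x0) implybT.
    rewrite powRr1 ?ltW// X2 mulfK ?gt_eqF ?powR_gt0//.
    by apply: eq_bigr => i _; rewrite grushin_weight_l vl mul1r divr1 mxE.
  rewrite /sqnorm mulr_sumr mulr_suml; apply: eq_bigr => i _.
  by rewrite grushin_weight_r vr mxE !exprMn exprVn.
have r2 : (rho z `^ gamma * rho z) ^+ 2 = gauge_base z.
  have -> : rho z `^ gamma * rho z = rho z `^ (1 + gamma).
    rewrite powRD; last by rewrite (gt_eqF r0) implybT.
    by rewrite powRr1 ?ltW// mulrC.
  rewrite -powR_mulrn ?powR_ge0// -powRrM gaugeE -powRrM.
  rewrite (_ : _ * _ = 1) ?powRr1 ?ltW//.
  have : 1 + gamma != 0 by rewrite gt_eqF.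
  by move=> ?; field.
have g0 : 0 <= grushin_grad_norm m k gamma f z by exact: sqrtr_ge0.
have r0' : 0 < rho z `^ gamma by exact: powR_gt0.
rewrite -(@ler_pXn2r _ 2)// ?nnegrE; last first.
  by rewrite !mulr_ge0 ?invr_ge0 ?(ltW X0) ?(ltW r0) ?(ltW r0').
rewrite exprMn (_ : X / _ / _ = X / (rho z `^ gamma * rho z)); last by rewrite invfM mulrA.
rewrite exprMn exprVn r2 real_normK ?num_real// E.
apply: le_trans (ler_wpM2l _ (cauchy_schwarz _ _)) _.
  by rewrite mulr_ge0 ?sqr_ge0// invr_ge0 ltW.
rewrite S1 S2 mulrA (_ : X ^+ 2 / gauge_base z * (gauge_base z / X ^+ 2) = 1) ?mul1r//.
have : gauge_base z != 0 by rewrite gt_eqF.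
have : X != 0 by rewrite gt_eqF.
by move=> ? ?; field; apply/andP.
Qed.

End gauge.

(** * Consequences of smoothness and compact support *)

Lemma compact_coord_bounded (R : realType) n (K : set 'rV[R]_n) :
  compact K -> exists M : R, forall z, K z -> forall i, `|z ord0 i| <= M.
Proof.
move=> /compact_bounded[M [_ KM]]; exists (M + 1) => z Kz i.
apply: le_trans (KM (M + 1) _ z Kz); last by rewrite ltrDl.
by rewrite [leRHS]/Num.norm /= mx_normrE; apply/bigmax_geP; right; exists (ord0, i).
Qed.

Lemma smooth_partial (R : realType) n (f : 'rV[R]_n -> R) (i : 'I_n) :
  smooth f -> (forall z, derivable f z (evec R i)) /\
    continuous (fun z => 'D_(evec R i) f z).
Proof.
by move=> sf; split; [exact: (sf [::]).2|exact: (sf [:: i]).1].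
Qed.

Lemma derive_outside_support (R : realType) n (f : 'rV[R]_n -> R)
    (K : set 'rV[R]_n) (z v : 'rV[R]_n) :
  compact K -> (forall x, ~ K x -> f x = 0) -> ~ K z -> 'D_v f z = 0.
Proof.
move=> cK fK Kz; rewrite -(derive_cst (0 : R) z v); apply: near_eq_derive.
have oK : open (~` K) by apply: closed_openC; apply: compact_closed.
by apply: filterS (open_nbhs_nbhs (conj oK Kz)) => x; exact: fK.
Qed.

(** * Measurability of the gauge and of the Grushin gradient *)

Section measurability.
Variables (R : realType) (m k : nat) (gamma : R).

Lemma vec_measurable_powR n (f : 'rV[R]_n -> R) (r : R) :
  vec_measurable (f : _ -> measurableTypeR R) ->
  vec_measurable ((fun z => f z `^ r) : _ -> measurableTypeR R).
Proof.
by move=> mf d T v mv; apply: (measurableT_comp (measurable_powR _)); exact: mf.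
Qed.

Lemma vec_measurableM n (f g : 'rV[R]_n -> R) :
  vec_measurable (f : _ -> measurableTypeR R) ->
  vec_measurable (g : _ -> measurableTypeR R) ->
  vec_measurable ((fun z => f z * g z) : _ -> measurableTypeR R).
Proof.
by move=> mf mg d T v mv; apply: measurable_funM; [exact: mf|exact: mg].
Qed.

Lemma vec_measurableV n (f : 'rV[R]_n -> R) :
  vec_measurable (f : _ -> measurableTypeR R) -> (forall z, 0 <= f z) ->
  vec_measurable ((fun z => (f z)^-1) : _ -> measurableTypeR R).
Proof.
move=> mf f0.
have := vec_measurable_powR (-1) mf.
by under eq_fun do rewrite powR_inv1//.
Qed.

Lemma vec_measurable_sqrt_sum n (I : finType) (f : I -> 'rV[R]_n -> R) :
  (forall i, vec_measurable (f i : _ -> measurableTypeR R)) ->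
  vec_measurable ((fun z => Num.sqrt (\sum_i f i z)) : _ -> measurableTypeR R).
Proof.
move=> mf d T v mv.
apply: (measurableT_comp (continuous_measurable_fun (@sqrt_continuous R))).
by apply: measurable_sum => i; exact: mf.
Qed.

Lemma vec_measurable_enorm_xpart :
  vec_measurable ((fun z : 'rV[R]_(m + k) => enorm (xpart z)) : _ -> measurableTypeR R).
Proof.
apply: vec_measurable_sqrt_sum => i d T v mv.
by apply: measurable_funX; under eq_fun do rewrite mxE; exact: mv.
Qed.

Lemma vec_measurable_enorm_ypart :
  vec_measurable ((fun z : 'rV[R]_(m + k) => enorm (ypart z)) : _ -> measurableTypeR R).
Proof.
apply: vec_measurable_sqrt_sum => i d T v mv.
by apply: measurable_funX; under eq_fun do rewrite mxE; exact: mv.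
Qed.

Lemma vec_measurable_gauge :
  vec_measurable (gauge m k gamma : _ -> measurableTypeR R).
Proof.
apply: vec_measurable_powR => d T v mv; apply: measurable_funD.
  exact: (vec_measurable_powR _ vec_measurable_enorm_xpart).
apply: measurable_funM => //; apply: measurable_funX.
exact: vec_measurable_enorm_ypart.
Qed.

Lemma vec_measurable_grushin_grad_norm (f : 'rV[R]_(m + k) -> R) :
  (forall i, continuous (fun z => 'D_(evec R i) f z)) ->
  vec_measurable (grushin_grad_norm m k gamma f : _ -> measurableTypeR R).
Proof.
move=> cf d T v mv.
apply: (measurableT_comp (continuous_measurable_fun (@sqrt_continuous R))).
apply: measurable_funD; apply: measurable_sum => i; apply: measurable_funX.
  exact: (continuous_vec_measurable (cf _)).
apply: measurable_funM; last exact: (continuous_vec_measurable (cf _)).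
exact: (vec_measurable_powR _ vec_measurable_enorm_xpart).
Qed.

End measurability.

(** * The Hardy inequality with the Grushin weight *)

Theorem theorem3p3 (R : realType) (m k : nat) (gamma : R)
  (Omega : set 'rV[R]_(m + k)) (alpha t p : R) (phi : 'rV[R]_(m + k) -> R) :
  (0 < m)%N -> (0 < k)%N -> 0 < gamma ->
  (Omega = [set: 'rV[R]_(m + k)] \/
   (domain Omega /\ smooth_boundary Omega /\ Omega 0)) ->
  1 <= p -> 0 < hom_dim m k gamma + alpha - p ->
  Ccinf Omega phi ->
  let rho := gauge m k gamma in
  let Grho := grushin_grad_norm m k gamma rho in
  ((((hom_dim m k gamma + alpha - p) / p) `^ p)%:E *
    integral_over Omega (fun z => (rho z `^ alpha * Grho z `^ t
                           * (Grho z `^ p / rho z `^ p) * `|phi z| `^ p)%R)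
  <= integral_over Omega (fun z => (rho z `^ alpha * Grho z `^ t
                           * grushin_grad_norm m k gamma phi z `^ p)%R))%E.
Proof.
move=> m0 _ gamma0 _ p1 Q0 [sphi [K [cK [KOmega phiK]]]].
cbv zeta; set rho := gauge m k gamma; set Grho := grushin_grad_norm m k gamma rho.
have p0 : 0 < p by exact: lt_le_trans p1.
have pN0 : p != 0 by rewrite gt_eqF.
have mk0 : (0 < m + k)%N by rewrite addn_gt0 m0.
have [M KM] := compact_coord_bounded cK.
have cphi : continuous phi := (sphi [::]).1.
have dphi i z : derivable phi z (evec R i) by exact: (smooth_partial i sphi).1.
have cdphi i : continuous (fun z => 'D_(evec R i) phi z).
  exact: (smooth_partial i sphi).2.
(* The closed form of [|grad rho|], proved equal to it only where [x] is nonzero. Unlike the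
   derivative, it is visibly measurable and dilation invariant everywhere, so the weight is built
   from it. *)
pose g (z : 'rV[R]_(m + k)) := enorm (xpart z) `^ gamma / rho z `^ gamma.
pose W z := rho z `^ alpha * g z `^ t * (g z `^ p / rho z `^ p).
have g0 z : 0 <= g z by rewrite divr_ge0 ?powR_ge0.
have rho0 z : 0 <= rho z by exact: powR_ge0.
have W0 z : 0 <= W z by rewrite !mulr_ge0 ?invr_ge0 ?powR_ge0.
have mrho := @vec_measurable_gauge R m k gamma.
have mg : vec_measurable (g : _ -> measurableTypeR R).
  apply: vec_measurableM.
    exact: vec_measurable_powR (@vec_measurable_enorm_xpart R m k).
  by apply: vec_measurableV => [|z]; [exact: vec_measurable_powR|exact: powR_ge0].
have mrg : vec_measurable ((fun z => rho z `^ alpha * g z `^ t) : _ -> measurableTypeR R).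
  by apply: vec_measurableM; exact: vec_measurable_powR.
have mW : vec_measurable (W : _ -> measurableTypeR R).
  apply: vec_measurableM => //; apply: vec_measurableM; first exact: vec_measurable_powR.
  by apply: vec_measurableV => [|z]; [exact: vec_measurable_powR|exact: powR_ge0].
pose w := @grushin_weight R m k gamma.
have Wh s z : W (dilation w s z) = expR ((alpha - p) * s) * W z.
  have rh : rho (dilation w s z) = expR s * rho z by exact: gauge_dilation.
  have gh : g (dilation w s z) = g z.
    rewrite /g rh xpart_dilation !powRM ?expR_ge0 ?enorm_ge0//.
    by rewrite invfM mulrACA divff ?mul1r// gt_eqF// powR_gt0// expR_gt0.
  have ra (a : R) : (expR s * rho z) `^ a = expR (a * s) * rho z `^ a.
    by rewrite (powRM _ (expR_ge0 _) (rho0 _)) expR_powR [a * s]mulrC.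
  rewrite /W gh rh (ra alpha) (ra p) mulrBl expRB invfM.
  move: (g z `^ t) (g z `^ p) (rho z `^ alpha) (rho z `^ p)^-1 => a1 a2 a3 a4.
  by move: (expR (alpha * s)) (expR (p * s))^-1 => a5 a6; ring.
have xpos (z : 'rV[R]_(m + k)) :
    (forall i : 'I_(m + k), val i = 0%N -> z ord0 i != 0) -> 0 < sqnorm (xpart z).
  move=> z0; apply: (@sqnorm_gt0 _ _ _ (Ordinal m0)).
  by rewrite mxE; exact: z0.
have GrhoE (z : 'rV[R]_(m + k)) : 0 < sqnorm (xpart z) -> Grho z = g z.
  exact: gauge_gradE.
have mgrad := vec_measurable_grushin_grad_norm gamma cdphi.
have mL : vec_measurable (fun z => (W z * `|phi z| `^ p)%:E).
  move=> d T v mv; apply/measurable_EFinP; apply: measurable_funM; first exact: mW.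
  apply: (measurableT_comp (measurable_powR _)).
  apply: (measurableT_comp (@normr_measurable _ setT)).
  exact: (continuous_vec_measurable cphi).
have mH : vec_measurable (fun z => (W z * `|euler_field w phi z| `^ p)%:E).
  move=> d T v mv; apply/measurable_EFinP; apply: measurable_funM; first exact: mW.
  apply: (measurableT_comp (measurable_powR _)).
  apply: (measurableT_comp (@normr_measurable _ setT)).
  exact: (continuous_vec_measurable (@continuous_euler_field _ _ w _ cdphi)).
have mR : vec_measurable (fun z =>
    (rho z `^ alpha * g z `^ t * grushin_grad_norm m k gamma phi z `^ p)%:E).
  move=> d T v mv; apply/measurable_EFinP; apply: measurable_funM; first exact: mrg.
  by apply: (measurableT_comp (measurable_powR _)); exact: mgrad.
have R0 z : 0 <= rho z `^ alpha * g z `^ t * grushin_grad_norm m k gamma phi z `^ p.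
  by rewrite !mulr_ge0 ?powR_ge0.
have -> : integral_over Omega (fun z => rho z `^ alpha * Grho z `^ t
    * (Grho z `^ p / rho z `^ p) * `|phi z| `^ p) =
    iint (fun z => (W z * `|phi z| `^ p)%:E).
  apply: eq_iint_hyperplane => //.
  - move=> z /xpos/GrhoE ->; rewrite indicE.
    have [_|zO] := boolP (z \in Omega); first by rewrite mul1r.
    rewrite mul0r phiK ?normr0 ?powR0 ?mulr0// => /KOmega.
    by move/mem_set; exact/negP.
  - by move=> z; rewrite lee_fin mulr_ge0 ?powR_ge0.
(* The same for the gradient term: the complement of [K] is open, so the partial derivatives of
   [phi] vanish there too. *)
have -> : integral_over Omega (fun z => rho z `^ alpha * Grho z `^ t
    * grushin_grad_norm m k gamma phi z `^ p) =
    iint (fun z => (rho z `^ alpha * g z `^ t *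
      grushin_grad_norm m k gamma phi z `^ p)%:E).
  apply: eq_iint_hyperplane => //.
  move=> z /xpos/GrhoE ->; rewrite indicE.
  have [_|zO] := boolP (z \in Omega); first by rewrite mul1r.
  have zK : ~ K z by move=> /KOmega/mem_set; exact/negP.
  rewrite mul0r (_ : grushin_grad_norm m k gamma phi z = 0) ?powR0 ?mulr0//.
  rewrite /grushin_grad_norm !big1 ?addr0 ?sqrtr0// => i _.
    by rewrite (derive_outside_support _ cK phiK zK) mulr0 expr0n.
  by rewrite (derive_outside_support _ cK phiK zK) expr0n.
have Qw : hom_dim m k gamma + alpha - p = \sum_i w i + (alpha - p).
  by rewrite sum_grushin_weight addrA.
rewrite Qw.
apply: le_trans (@dilation_hardy R (m + k) w phi W (alpha - p) p M mk0 _ dphi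
  cdphi cphi _ mW W0 Wh p1 _) _.
- exact: grushin_weight_gt0.
- move=> z phiz; apply: KM; apply: contrapT => /phiK phi0.
  by rewrite phi0 eqxx in phiz.
- by rewrite -Qw.
(* It remains to raise [euler_field_le] to the power [p] and integrate it against
   [rho^alpha g^t]. *)
apply: le_iint_hyperplane => //.
- by move=> z; rewrite lee_fin mulr_ge0 ?powR_ge0.
move=> z /xpos x0; rewrite lee_fin /W -mulrA ler_wpM2l ?mulr_ge0 ?powR_ge0//.
have ir0 : 0 <= (rho z)^-1 by rewrite invr_ge0.
have gr0 := mulr_ge0 (g0 z) ir0.
have -> : g z `^ p / rho z `^ p * `|euler_field w phi z| `^ p =
    (g z / rho z * `|euler_field w phi z|) `^ p.
  rewrite (powRM _ gr0 (normr_ge0 _)) (powRM _ (g0 z) ir0).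
  by rewrite -(powR_inv1 (rho0 z)) -[in RHS]powRrM mulN1r powRN.
apply: ge0_ler_powR; first exact: ltW.
- by rewrite nnegrE; exact: mulr_ge0 gr0 (normr_ge0 _).
- by rewrite nnegrE; exact: sqrtr_ge0.
- exact: (euler_field_le gamma0).
Qed.
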